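(* Let $\xi^1,\xi^2,\xi^3\in\{1,-1\}^N$ with $\xi^k\neq\pm\xi^l$ for $k\neq l$. Define the subsets of $\{1,\dots,N\}$ $$J_{11}=\{j:\xi^2_j=\xi^3_j=\xi^1_j\},\quad J_{12}=\{j:\xi^2_j=\xi^3_j=-\xi^1_j\},\quad J_{21}=\{j:\xi^2_j=-\xi^3_j=\xi^1_j\},\quad J_{22}=\{j:\xi^2_j=-\xi^3_j=-\xi^1_j\},$$ and assume that all four are nonempty. For $\varepsilon>0$ consider the system $$\dot\varphi_i=\frac1N\sum_{j=1}^N(\xi^1_i\xi^1_j+\xi^2_i\xi^2_j+\xi^3_i\xi^3_j)\sin(\varphi_j-\varphi_i)+\frac{\varepsilon}{N}\sum_{j=1}^N\sin2(\varphi_j-\varphi_i),\qquad i=1,\dots,N.$$ Then for each $l\in\{1,2,3\}$ the equilibrium $\varphi^*(\xi^l)$ is asymptotically stable if $\varepsilon\in(\varepsilon^*_{\xi^l},\infty)$ and unstable if $\varepsilon\in(0,\varepsilon^*_{\xi^l})$, where $$\varepsilon^*_{\xi^1}=\left|\frac{|J_{11}\cup J_{12}|}{N}-\frac12\right|,\qquad \varepsilon^*_{\xi^2}=\left|\frac{|J_{11}\cup J_{22}|}{N}-\frac12\right|,\qquad \varepsilon^*_{\xi^3}=\left|\frac{|J_{11}\cup J_{21}|}{N}-\frac12\right|.$$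
   Context: For a binary pattern $\eta\in\{1,-1\}^N$, $\varphi^*(\eta)$ denotes the phase-locked bipolar equilibrium of the system, unique up to adding a common constant to all phases, with $|\varphi^*_i(\eta)-\varphi^*_j(\eta)|=0 \bmod 2\pi$ if $\eta_i=\eta_j$ and $|\varphi^*_i(\eta)-\varphi^*_j(\eta)|=\pi \bmod 2\pi$ if $\eta_i\neq\eta_j$. Stability is in the Lyapunov sense; since the vector field is invariant under $\varphi\mapsto\varphi+c(1,\dots,1)$, asymptotic stability is understood modulo this global phase shift (equivalently, restricted to the invariant hyperplane $\sum_i\varphi_i=\mathrm{const}$ through the equilibrium). Unstable means not stable. *)

(* Defs.v *)
From HB Require Import structures.
From mathcomp Require Import all_boot all_order all_algebra.
From mathcomp Require Import all_classical all_reals all_analysis.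

Set Implicit Arguments.
Unset Strict Implicit.
Unset Printing Implicit Defensive.

Import Order.TTheory GRing.Theory Num.Theory.
Import numFieldNormedType.Exports.

Local Open Scope classical_set_scope.
Local Open Scope ring_scope.

Section AutonomousSystem.
Variables (R : realType) (N : nat).
Implicit Types (F : 'rV[R]_N -> 'rV[R]_N) (p : 'rV[R]_N) (x : R -> 'rV[R]_N).

(* Only forward time matters: the values of x at negative times are
   unconstrained, and at time 0 only continuity from the right is required
   (the right derivative at 0 is then F (x 0) as soon as F is continuous). *)
Definition forward_solution F x : Prop :=
  {within `[0, +oo[, continuous x} /\
  forall t : R, 0 < t -> is_derive t 1 x (F (x t)).

Definition equilibrium F p : Prop := F p = 0.

Definition lyapunov_stable F p : Prop :=
  forall e : R, 0 < e -> exists2 d : R, 0 < d &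
    forall x, forward_solution F x -> `|x 0 - p| < d ->
      forall t : R, 0 <= t -> `|x t - p| < e.

(* The distance from x t to the line p + R (1, ..., 1) tends to 0. *)
Definition attractive_mod_shift F p : Prop :=
  exists2 d : R, 0 < d &
    forall x, forward_solution F x -> `|x 0 - p| < d ->
      forall e : R, 0 < e ->
        \forall t \near +oo, exists c : R, `|x t - (p + const_mx c)| < e.

Definition asymptotically_stable_mod_shift F p : Prop :=
  lyapunov_stable F p /\ attractive_mod_shift F p.

Definition unstable F p : Prop := ~ lyapunov_stable F p.

End AutonomousSystem.

Section OscillatorNetwork.
Variables (R : realType) (N : nat).
Implicit Types (eta phi : 'rV[R]_N) (eps : R).

Definition binary_pattern eta : Prop :=
  forall i, eta 0 i = 1 \/ eta 0 i = -1.

Definition oscillator_field (xi1 xi2 xi3 : 'rV[R]_N) eps phi : 'rV[R]_N :=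
  \row_i (N%:R^-1 * (\sum_(j < N)
            (xi1 0 i * xi1 0 j + xi2 0 i * xi2 0 j + xi3 0 i * xi3 0 j)
              * sin (phi 0 j - phi 0 i))
          + eps / N%:R * (\sum_(j < N) sin (2 * (phi 0 j - phi 0 i)))).

Definition bipolar eta phi : Prop :=
  forall i j, exists k : int,
    `|phi 0 i - phi 0 j| =
      (if eta 0 i == eta 0 j then 0 else pi) + k%:~R * (2 * pi).

Definition J11 (xi1 xi2 xi3 : 'rV[R]_N) : {set 'I_N} :=
  [set j | (xi2 0 j == xi3 0 j) && (xi3 0 j == xi1 0 j)]%SET.
Definition J12 (xi1 xi2 xi3 : 'rV[R]_N) : {set 'I_N} :=
  [set j | (xi2 0 j == xi3 0 j) && (xi3 0 j == - xi1 0 j)]%SET.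
Definition J21 (xi1 xi2 xi3 : 'rV[R]_N) : {set 'I_N} :=
  [set j | (xi2 0 j == - xi3 0 j) && (- xi3 0 j == xi1 0 j)]%SET.
Definition J22 (xi1 xi2 xi3 : 'rV[R]_N) : {set 'I_N} :=
  [set j | (xi2 0 j == - xi3 0 j) && (- xi3 0 j == - xi1 0 j)]%SET.

(* phi ranges over all representatives of the bipolar equilibrium of eta,
   which is only determined up to a global phase shift and multiples of 2 pi. *)
Definition stability_threshold (xi1 xi2 xi3 : 'rV[R]_N) eta (eps_star : R) : Prop :=
  forall eps phi, 0 < eps -> bipolar eta phi ->
    let F := oscillator_field xi1 xi2 xi3 eps in
    [/\ equilibrium F phi,
        eps_star < eps -> asymptotically_stable_mod_shift F phi &
        eps < eps_star -> unstable F phi].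

End OscillatorNetwork.

(* Main.v *)
Require Import Defs.
From mathcomp Require Import all_boot all_order all_algebra.
From mathcomp Require Import all_classical all_reals all_analysis.
From mathcomp Require Import ring lra.
Import Order.TTheory GRing.Theory Num.Theory.
Import numFieldNormedType.Exports.
Local Open Scope classical_set_scope.
Local Open Scope ring_scope.

Set Implicit Arguments.
Unset Strict Implicit.
Unset Printing Implicit Defensive.

(** Writing a phase vector as phi + v, with phi the bipolar equilibrium of a
    pattern a, turns the network into
      v_i' = 1/N sum_j (K_ij sin (v_j - v_i) + eps sin 2 (v_j - v_i)),
      K_ij = 1 + a_i a_j b_i b_j + a_i a_j c_i c_j,
    where b, c are the other two patterns.  With s_i = b_i c_i one has
      K_ij + s_i s_j = (1 + a_i a_j b_i b_j) (1 + a_i a_j c_i c_j) >= 0,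
    so the Dirichlet form of the linearization dominates that of the weights
    2 eps - s_i s_j, whose smallest nonzero eigenvalue is controlled by
    eps - |sum_i s_i| / (2 N), i.e. by eps minus the threshold.  Above the threshold
    sum_ij (v_j - v_i)^2 is therefore a strict Lyapunov function, while
    sum_i v_i is conserved.

    Below the threshold, split the majority class of s into two groups according
    to a_i b_i and keep the minority class as a third group.  Phases that are
    constant on each group form an invariant space; there, with x the difference of
    the first two phases and z a multiple of the difference between their weighted
    mean and the third, x^2 - z^2 grows at least linearly along the solutions that
    start at z = 0 <> x and stay close to the equilibrium.  Such solutions exist by
    Picard iteration. *)

(** * Monotonicity, geometric limits and primitives of real functions *)

Section RealAnalysis.
Variable R : realType.
Implicit Types (f g df dg : R -> R).

Lemma deriv_le_nonincreasing f df (a b : R) : 0 <= a -> a <= b ->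
  {within `[0, +oo[, continuous f} ->
  (forall t, a < t < b -> is_derive t 1 f (df t) /\ df t <= 0) ->
  f b <= f a.
Proof.
move=> a0 ab cf dfP.
have cab : {within `[a, b], continuous f}.
  apply: continuous_subspaceW cf; apply: subset_itv => //; rewrite bnd_simp //.
(* The mean value theorem places its point [c] only in the closed interval, and the sign of [df] is
   known only inside. Truncating to 0 gives a nonpositive value wherever [c] falls. *)
pose g t := if a < t < b then df t else 0.
have gP t : t \in `]a, b[ -> is_derive t 1 f (g t).
  by rewrite in_itv /= /g => tab; rewrite tab; case: (dfP t tab).
have [c _ E] := MVT_segment ab gP cab.
rewrite -subr_le0 E /g; case: ifP => [/dfP[_ dfc]|_]; last by rewrite mul0r.
by rewrite mulr_le0_ge0 // subr_ge0.
Qed.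

(** With [e n] equal to [2 * C / 2 ^+ n], the intervals from [u n - e n] to [u n + e n] are nested,
    and the supremum of the left endpoints lies in all of them. The explicit rate is what makes the
    Picard limit continuous. *)
Lemma geometric_limit (u : nat -> R) (C : R) :
  (forall n, `|u n.+1 - u n| <= C / 2 ^+ n) ->
  exists l, forall n, `|l - u n| <= 2 * C / 2 ^+ n.
Proof.
move=> uC; pose e n := 2 * C / 2 ^+ n.
have eS n : e n = 2 * e n.+1.
  by rewrite /e exprS; field; rewrite expf_neq0.
have eE n : C / 2 ^+ n = e n.+1.
  have := eS n; rewrite /e -mulrA => /mulfI; apply; exact: lt0r_neq0.
have stepl n : u n - e n <= u n.+1 - e n.+1.
  by have := uC n; rewrite eE ler_norml (eS n) => /andP[]; lra.
have stepr n : u n.+1 + e n.+1 <= u n + e n.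
  by have := uC n; rewrite eE ler_norml (eS n) => /andP[]; lra.
have e0 n : 0 <= e n by rewrite eS mulr_ge0 // -eE (le_trans _ (uC n)).
have ml n k : u n - e n <= u (n + k)%N - e (n + k)%N.
  elim: k => [|k IH]; first by rewrite addn0.
  by rewrite addnS (le_trans IH).
have mr n k : u (n + k)%N + e (n + k)%N <= u n + e n.
  elim: k => [|k IH]; first by rewrite addn0.
  by rewrite addnS (le_trans _ IH).
have lr n m : u n - e n <= u m + e m.
  have [nm|/ltnW nm] := leqP n m.
    have := ml n (m - n)%N; rewrite subnKC // => h.
    by apply: le_trans h _; have := e0 m; lra.
  have := mr m (n - m)%N; rewrite subnKC // => h.
  by apply: le_trans h; have := e0 n; lra.
pose A := range (fun n => u n - e n).
have Aub n : ubound A (u n + e n) by move=> _ [m _ <-].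
have A0 : A !=set0 by exists (u 0%N - e 0%N); exists 0%N.
exists (sup A) => n; rewrite ler_norml; apply/andP; split.
  have : u n - e n <= sup A.
    by apply: ub_le_sup; [exists (u 0%N + e 0%N) | exists n].
  by rewrite -/(e n); lra.
have : sup A <= u n + e n by apply: ge_sup.
by rewrite -/(e n); lra.
Qed.

Lemma le0_of_le_geometric (a C : R) : (forall n, a <= C / 2 ^+ n) -> a <= 0.
Proof.
move=> aC; rewrite leNgt; apply/negP => a0.
have C0 : 0 < C by have := aC 0%N; rewrite expr0 divr1; exact: lt_le_trans.
have [n Cn] : exists n : nat, C / a < n%:R.
  by exists (Num.bound (C / a)); apply: archi_boundP; rewrite divr_ge0 // ltW.
have := aC n; rewrite leNgt => /negP; apply.
rewrite ltr_pdivrMr ?exprn_gt0 // mulrC -ltr_pdivrMr //.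
by apply: lt_trans Cn _; rewrite -natrX ltr_nat ltn_expl.
Qed.

(** Freezing the primitive at 0 for negative times keeps it continuous on the whole line, so that
    Picard iterates are globally continuous functions differentiated only at positive times. *)
Lemma primitive_exists f : continuous f ->
  exists P : R -> R, [/\ continuous P, forall t : R, t <= 0 -> P t = 0 &
    forall t : R, 0 < t -> is_derive t 1 P (f t)].
Proof.
move=> cf.
(* Starting the integral at -1 makes the primitive differentiable at 0 too. *)
pose G (x : R) : R := (\int[lebesgue_measure]_(t in [set` `[-1, x]]) (f t))%R.
have GP (t : R) : -1 < t -> is_derive t 1 G (f t).
  move=> t1.
  have [||d1 d2] := @continuous_FTC1_closed R f (-1) t (t + 1) _ _ t1 (cf t).
  - by rewrite ltrDl.
  - apply: continuous_compact_integrable; first exact: segment_compact.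
    exact: continuous_subspaceT.
  - by apply: DeriveDef; [exact: d1 | rewrite -derive1E].
pose P (t : R) := G (Num.max t 0) - G 0.
have cG (t : R) : -1 < t -> {for t, continuous G}.
  move=> /GP [d _]; apply: differentiable_continuous; exact/derivable1_diffP.
exists P; split.
- move=> t; apply: cvgB; last exact: cvg_cst.
  apply: (@continuous_comp _ _ _ (fun t : R => Num.max t 0) G).
    by apply: continuous_max; [exact: cvg_id | exact: cvg_cst].
  by apply: cG; rewrite lt_max ltrN10 orbT.
- by move=> t t0; rewrite /P max_r // subrr.
- move=> t t0.
  have : is_derive t 1 (G - cst (G 0)) (f t).
    have h := GP t (lt_trans (ltrN10 _) t0).
    by apply: is_derive_eq; rewrite subr0.
  apply: near_eq_is_derive.
  near=> s; rewrite /P max_l //.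
  by apply: ltW; near: s; exact: lt_nbhsr.
Unshelve. all: by end_near. Qed.
End RealAnalysis.

(** * Picard iteration *)

Section Picard.
Variable R : realType.

(** Both [f] and [- f], minus [C / k * expR (k * t)], have nonpositive derivative at positive times
    and start at [- C / k]. Dividing by [k] is the source of the contraction factor below. *)
Lemma norm_le_expR (f df : R -> R) (C k : R) : 0 < k -> f 0 = 0 -> 0 <= C ->
  continuous f -> (forall t : R, t <= 0 -> f t = 0) ->
  (forall t : R, 0 < t -> is_derive t 1 f (df t)) ->
  (forall t : R, 0 < t -> `|df t| <= C * expR (k * `|t|)) ->
  forall t : R, `|f t| <= C / k * expR (k * `|t|).
Proof.
move=> k0 f0 C0 cf fN dfP dfC t.
have Ck : 0 <= C / k by rewrite divr_ge0 // ltW.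
have [t0|t0] := leP t 0.
  by rewrite fN // normr0 mulr_ge0 // expR_ge0.
have key (s : R) : `|s| = 1 -> s * f t <= C / k * expR (k * t).
  move=> s1.
  pose g := s *: f - (C / k) *: (expR \o ( *%R k)).
  have gP (u : R) : 0 < u < t -> is_derive u 1 g (s * df u - C * expR (k * u)) /\
      s * df u - C * expR (k * u) <= 0.
    move=> /andP[u0 _]; split; last first.
      rewrite subr_le0 (le_trans (ler_norm _)) // normrM s1 mul1r.
      by have := dfC u u0; rewrite (gtr0_norm u0).
    have h := dfP u u0.
    have hk : is_derive u 1 ( *%R k) k.
      have : is_derive u 1 (k *: (@idfun R)) (k *: 1) by exact: is_deriveZ.
      by rewrite /GRing.scale /= mulr1.
    apply: is_derive_eq.
    rewrite /GRing.scale /=; congr (_ - _).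
    by rewrite [expR _ * k]mulrC mulrA divfK // gt_eqF.
  have cg : continuous g.
    move=> u; apply: cvgB; first by apply: cvgZr; exact: cf.
    apply: cvgZr; apply: continuous_comp; first exact: mulrl_continuous.
    exact: continuous_expR.
  have := deriv_le_nonincreasing (lexx 0) (ltW t0) (continuous_subspaceT cg) gP.
  rewrite /g /= !fctE f0 mulr0 scaler0 expR0 /GRing.scale /= => h.
  by rewrite -subr_le0; apply: le_trans h _; rewrite sub0r mulr1 oppr_le0.
rewrite (gtr0_norm t0) ler_norml lerNl.
have := key 1 (normr1 _); have := key (-1); rewrite normrN1 mul1r mulN1r => /(_ erefl).
by move=> -> ->.
Qed.

Variables (I : finType) (G : (I -> R) -> I -> R) (L : R).
Hypothesis L0 : 0 < L.
Hypothesis G_lip : forall (u v : I -> R) (d : R),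
  (forall j, `|u j - v j| <= d) -> forall i, `|G u i - G v i| <= L * d.

Lemma lipschitz_comp_continuous (x : I -> R -> R) :
  (forall i, continuous (x i)) -> forall i, continuous (fun t => G (x^~ t) i).
Proof.
move=> cx i t; apply/cvgrPdist_le => e e0.
have eL : 0 < e / L by rewrite divr_gt0.
near=> s.
rewrite (_ : e = L * (e / L)); last by rewrite mulrC divfK // gt_eqF.
apply: G_lip; near: s; apply: filter_forall => j.
by have /cvgrPdist_le := cx j t; apply.
Unshelve. all: by end_near. Qed.

(** [y] is the image of [x] under the Picard operator with initial value [u0], described by its
    derivative instead of an integral. *)
Definition integrates (x y : I -> R -> R) (u0 : I -> R) :=
  [/\ forall i, continuous (y i), forall i (t : R), t <= 0 -> y i t = u0 i &
    forall i (t : R), 0 < t -> is_derive t 1 (y i) (G (x^~ t) i)].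

Lemma integrates_exists (u0 : I -> R) (x : I -> R -> R) :
  (forall i, continuous (x i)) -> exists y, integrates x y u0.
Proof.
move=> cx.
have /choice[P PP] := fun i => primitive_exists (@lipschitz_comp_continuous x cx i).
exists (fun i => cst (u0 i) + P i); split => i.
- by move=> t; apply: cvgD; [exact: cvg_cst | case: (PP i) => c _ _; exact: c].
- by move=> t t0; case: (PP i) => _ z _; rewrite fctE z // addr0.
- move=> t t0; case: (PP i) => _ _ d; have h := d t t0.
  by apply: is_derive_eq; rewrite add0r.
Qed.

(* With the weight [expR (2 * L * `|t|)] the Picard operator contracts distances
   by 1/2 on the whole half-line, so no continuation argument is needed. *)
Lemma integrates_dist (u0 : I -> R) x y x' y' (C : R) : 0 <= C ->
  integrates x y u0 -> integrates x' y' u0 ->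
  (forall i t, `|x i t - x' i t| <= C * expR (2 * L * `|t|)) ->
  forall i t, `|y i t - y' i t| <= C / 2 * expR (2 * L * `|t|).
Proof.
move=> C0 [cy y0 dy] [cy' y0' dy'] xx' i t.
have k0 : 0 < 2 * L by rewrite mulr_gt0.
have -> : C / 2 = L * C / (2 * L) by field; rewrite gt_eqF.
apply: (@norm_le_expR (y i - y' i) (fun t => G (x^~ t) i - G (x'^~ t) i)) => //.
- by rewrite !fctE y0 // y0' // subrr.
- by rewrite mulr_ge0 // ltW.
- by move=> s; apply: cvgB; [exact: cy | exact: cy'].
- by move=> s s0; rewrite !fctE y0 // y0' // subrr.
- by move=> s s0; have h1 := dy i s s0; have h2 := dy' i s s0; exact: is_deriveB.
- by move=> s s0; rewrite -mulrA; apply: G_lip.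
Qed.

(** The iterates started at the constant [u0] converge geometrically in the exponentially weighted
    norm, and the limit is a fixed point of the Picard operator. *)
Theorem picard_lindelof (u0 : I -> R) : exists x : I -> R -> R,
  [/\ forall i, continuous (x i), forall i, x i 0 = u0 i &
   forall i (t : R), 0 < t -> is_derive t 1 (x i) (G (x^~ t) i)].
Proof.
(* Bundling continuity with the function lets the axiom of choice select a next iterate, which can
   then be iterated. *)
pose T := {x : I -> R -> R | forall i, continuous (x i)}.
have nextP (x : T) : exists y : T, integrates (sval x) (sval y) u0.
  have [y yP] := integrates_exists u0 (svalP x).
  by exists (exist _ y (let: And3 c _ _ := yP in c)).
have [next nP] := choice nextP.
have c0 : forall i, continuous ((fun i => cst (u0 i)) i : R -> R).
  by move=> i; exact: cst_continuous.
pose s n := iter n next (exist _ (fun i => cst (u0 i)) c0 : T).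
pose x n := sval (s n).
have xS n : integrates (x n) (x n.+1) u0 by exact: nP.
have cx n i : continuous (x n i) := svalP (s n) i.
have k0 : 0 < 2 * L by rewrite mulr_gt0.
pose E (t : R) := expR (2 * L * `|t|).
have E0 t : 0 < E t by exact: expR_gt0.
have E1 t : 1 <= E t by rewrite -expR0 ler_expR mulr_ge0 // ltW.
(* [M] bounds the derivative of the first increment, and [B] is the resulting bound on that
   increment in the weighted norm. *)
pose M := \sum_i `|G u0 i|.
have M0 : 0 <= M by apply: sumr_ge0.
pose B := M / (2 * L).
have B0 : 0 <= B by rewrite divr_ge0 // ltW.
have xB n i t : `|x n.+1 i t - x n i t| <= B / 2 ^+ n * E t.
  elim: n i t => [|n IH] i t; last first.
    rewrite exprSr invfM mulrA.
    by apply: (integrates_dist _ (xS _) (xS _)) => //; rewrite divr_ge0 // exprn_ge0.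
  have [c1 x1 d1] := xS 0%N.
  rewrite expr0 divr1.
  apply: (@norm_le_expR (x 1%N i - cst (u0 i)) (fun t => G (x 0%N ^~ t) i)) => //.
  - by rewrite !fctE x1 // subrr.
  - by move=> r; apply: cvgB; [exact: c1 | exact: cvg_cst].
  - by move=> r r0; rewrite !fctE x1 // subrr.
  - by move=> r r0; have h := d1 i r r0; apply: is_derive_eq; rewrite subr0.
  - move=> r r0; apply: (@le_trans _ _ (M * 1)); last by rewrite ler_wpM2l // E1.
    by rewrite mulr1 /M (bigD1 i) //= lerDl sumr_ge0.
have limP (it : I * R) : exists l, forall n,
    `|l - x n it.1 it.2| <= 2 * (B * E it.2) / 2 ^+ n.
  by apply: geometric_limit => n; rewrite mulrAC; exact: xB.
have [X0 X0P] := choice limP.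
pose X i t := X0 (i, t).
have XP n i t : `|X i t - x n i t| <= 2 * B / 2 ^+ n * E t.
  by have := X0P (i, t) n => /=; rewrite -/(X i t) mulrA mulrAC.
have cX i : continuous (X i).
  move=> t; apply/cvgrPdist_le => e e0.
  (* The weight [E] is bounded on the window of radius 1 around [t], so one index [n] gives an error
     below [e / 3] on the whole window. *)
  pose K := 2 * B * E (`|t| + 1).
  have [n Kn] : exists n, K / 2 ^+ n < e / 3.
    apply: contrapT => /forallNP h.
    have : e / 3 <= 0.
      by apply: (@le0_of_le_geometric _ _ K) => n; rewrite leNgt; apply/negP/h.
    by rewrite leNgt divr_gt0.
  have Kt (r : R) : `|r| <= `|t| + 1 -> `|X i r - x n i r| <= e / 3.
    move=> rt; apply: le_trans (XP n i r) _; apply: le_trans (ltW Kn).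
    rewrite /K [leRHS]mulrAC.
    apply: ler_wpM2l; first by apply: divr_ge0; [exact: mulr_ge0 | exact: exprn_ge0].
    rewrite /E ler_expR ler_pM2l //.
    by rewrite (ger0_norm (addr_ge0 (normr_ge0 _) ler01)).
  near=> r.
  have r1 : `|t - r| <= 1.
    by near: r; have /cvgrPdist_le := @cvg_id _ (nbhs t); apply.
  have h1 := Kt t (ler_wpDr ler01 (lexx _)).
  have h2 : `|X i r - x n i r| <= e / 3.
    apply: Kt; rewrite -[r in `|r|](subKr t).
    by apply: le_trans (ler_normB _ _) _; rewrite lerD2l.
  have h3 : `|x n i t - x n i r| <= e / 3.
    by near: r; have /cvgrPdist_le := cx n i t; apply; rewrite divr_gt0.
  by move: h1 h2 h3; rewrite !ler_norml => /andP[? ?] /andP[? ?] /andP[? ?]; lra.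
(* No limit is differentiated: the Picard image [Y] of [X] has the right derivative by construction,
   and it equals [X] because both are geometrically close to the iterate [x n.+1] for every [n]. *)
have [Y YP] := integrates_exists u0 cX.
have YX i t : Y i t = X i t.
  apply/eqP; rewrite -subr_eq0 -normr_le0.
  apply: (@le0_of_le_geometric _ _ (2 * B * E t)) => n.
  have h1 : `|Y i t - x n.+1 i t| <= 2 * B / 2 ^+ n / 2 * E t.
    apply: (integrates_dist _ YP (xS n)); last exact: XP.
    by apply: divr_ge0; [exact: mulr_ge0 | exact: exprn_ge0].
  have h2 := XP n.+1 i t.
  have -> : 2 * B * E t / 2 ^+ n = 2 * B / 2 ^+ n / 2 * E t + 2 * B / 2 ^+ n.+1 * E t.
    by rewrite exprS; field; rewrite expf_neq0.
  rewrite -[_ - X i t](subrKA (x n.+1 i t)).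
  by apply: le_trans (ler_normD _ _) _; rewrite lerD // distrC.
have [cY Y0 dY] := YP.
exists Y; split => // [i|i t t0]; first by rewrite Y0.
have -> : Y ^~ t = X ^~ t by apply: funext => j; exact: YX.
exact: dY.
Unshelve. all: by end_near. Qed.
End Picard.

(** * Coordinatewise derivatives, continuity and norm of row vectors *)

Section Solutions.
Variables (R : realType) (N : nat).
Implicit Types (F : 'rV[R]_N -> 'rV[R]_N) (x : R -> 'rV[R]_N).

Lemma is_derive_rowP x (t : R) (d : 'rV[R]_N) :
  is_derive t 1 x d <-> forall i, is_derive t 1 (fun s => x s 0 i) (d 0 i).
Proof.
split => [[dx xd] i | h].
  have /derivable_mxP dx' := dx.
  apply: DeriveDef; first exact: dx'.
  by rewrite -xd derive_mx // mxE.
have dx : derivable x t 1.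
  by apply/derivable_mxP => i j; rewrite ord1; case: (h j).
apply: DeriveDef => //; rewrite derive_mx //; apply/rowP => i; rewrite mxE.
by case: (h i).
Qed.

Lemma continuous_rowP (T : topologicalType) (x : T -> 'rV[R]_N) :
  (forall i, continuous (fun s => x s 0 i)) -> continuous x.
Proof.
move=> cx t; apply/cvgrPdist_le => e e0; near=> s.
rewrite /Num.Def.normr /= mx_normrE (bigmax_le _ (ltW e0)) //= => -[i j] _.
rewrite !mxE /= ord1; move: j; near: s; apply: filter_forall => j.
by have /cvgrPdist_le := cx j t; apply.
Unshelve. all: by end_near. Qed.

Lemma continuous_bigsum (T : topologicalType) (I : finType) (f : I -> T -> R) :
  (forall i, continuous (f i)) -> continuous (fun t => \sum_i f i t).
Proof.
move=> cf; rewrite (_ : (fun t => _) = \sum_i f i); last first.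
  by apply: funext => t; rewrite fct_sumE.
elim/big_ind : _ => [|g h cg ch|i _]; last exact: cf.
- exact: cst_continuous.
- by move=> t; apply: cvgD; [exact: cg | exact: ch].
Qed.

Lemma row_norm_ltP (v : 'rV[R]_N) (e : R) : 0 < e ->
  `|v| < e <-> forall i, `|v 0 i| < e.
Proof.
move=> e0; rewrite {1}/Num.Def.normr /= mx_normrE; split => [h i|h].
  exact: le_lt_trans (le_bigmax _ (fun ij => `|v ij.1 ij.2|) (0, i)) h.
by apply: bigmax_lt => // -[i j] _; rewrite ord1 /=; exact: h.
Qed.
End Solutions.

(** * Lipschitz bound and linearization of the sine *)

Section SinEstimates.
Variable R : realType.
Implicit Types z : R.

Lemma sin_lipschitz (u v : R) : `|sin u - sin v| <= `|u - v|.
Proof.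
wlog uv : u v / u <= v => [h|].
  by have [/h //|/ltW /h] := leP u v; rewrite distrC (distrC v).
have cs : {within `[u, v], continuous (@sin R)}.
  by apply: continuous_subspaceT; exact: continuous_sin.
have [c _ E] := MVT_segment uv (fun x _ => is_derive_sin x) cs.
by rewrite distrC E normrM distrC -[leRHS]mul1r ler_wpM2r // cos_max.
Qed.

(** The derivative [cos - 1] of [sin z - z] is at most [r] in absolute value near 0, by continuity
    of the cosine; the mean value theorem between 0 and [z] gives the bound. *)
Lemma sin_near0 (r : R) : 0 < r ->
  exists2 d, 0 < d & forall z, `|z| < d -> `|sin z - z| <= r * `|z|.
Proof.
move=> r0.
have cc : {for 0, continuous (@cos R)} by exact: continuous_cos.
have /cvgrPdist_le /(_ r r0) /nbhs_ballP [d /= d0 hd] := cc.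
exists d => // z zd.
have key (u v : R) : - d < u -> u <= v -> v < d ->
    `|sin u - u - (sin v - v)| <= r * `|u - v|.
  move=> u1 uv v1.
  pose f := @sin R - @idfun R.
  have fP (s : R) : s \in `]u, v[ -> is_derive s 1 f (cos s - 1).
    by move=> _; apply: is_deriveB.
  have cf : {within `[u, v], continuous f}.
    apply: continuous_subspaceT => s; apply: cvgB; last exact: cvg_id.
    exact: continuous_sin.
  have [c + E] := MVT_segment uv fP cf.
  rewrite in_itv /= => /andP[uc cv].
  rewrite distrC; move: E; rewrite /f !fctE /= => ->.
  rewrite normrM distrC (distrC u) ler_wpM2r // -[in leLHS]cos0.
  apply: hd; rewrite /ball /= sub0r normrN ltr_norml.
  by rewrite (lt_le_trans u1 uc) (le_lt_trans cv v1).
move: zd; rewrite ltr_norml => /andP[z1 z2].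
have [z0|/ltW z0] := leP 0 z.
  have := key 0 z; rewrite sin0 subrr !sub0r !normrN; apply => //.
  by rewrite oppr_lt0.
by have := key z 0; rewrite sin0 subrr !subr0; apply.
Qed.
End SinEstimates.

(** * Trapping below a level *)

Section Barrier.
Variable R : realType.

(** Let [s] be the infimum of the times at which [W] is at least [M]. Before [s] the function is
    nonincreasing, so [W s <= W 0 < M], and continuity keeps [W] below [M] for a while after [s],
    contradicting the choice of [s]. *)
Lemma barrier (W dW : R -> R) (M : R) : {within `[0, +oo[, continuous W} ->
  (forall t : R, 0 < t -> is_derive t 1 W (dW t)) ->
  (forall t : R, 0 < t -> W t < M -> dW t <= 0) -> W 0 < M ->
  forall t : R, 0 <= t -> W t < M.
Proof.
move=> cW dWP dW0 W0 t1 t10; rewrite ltNge; apply/negP => Wt1.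
pose A := [set t : R | 0 <= t /\ M <= W t].
have A0 : A !=set0 by exists t1.
have lbA : lbound A 0 by move=> t [].
have hlb : has_lbound A by exists 0.
pose s := inf A.
have s0 : 0 <= s by exact: lb_le_inf.
have before t : 0 <= t -> t < s -> W t < M.
  move=> t0 ts; rewrite ltNge; apply/negP => Mt.
  by move: ts; rewrite ltNge ge_inf.
have Ws : W s < M.
  apply: le_lt_trans W0; apply: (deriv_le_nonincreasing (df := dW)) => // t /andP[t0 ts].
  by split; [exact: dWP | apply: dW0 => //; apply: before => //; exact: ltW].
have /subspace_continuousP /(_ s) := cW; rewrite /= in_itv /= s0 /= => /(_ isT) cs.
have MW : 0 < M - W s by rewrite subr_gt0.
have /cvgrPdist_lt /(_ _ MW) := cs.
rewrite near_withinE => /nbhs_ballP [d /= d0 hd].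
have : s + d <= s.
  apply: lb_le_inf => // t [t0 Mt]; rewrite leNgt; apply/negP => tsd.
  have st : s <= t by apply: ge_inf.
  have := hd t; rewrite /ball /= in_itv /= t0 /= distrC ger0_norm ?subr_ge0 //.
  rewrite ltrBlDl => /(_ tsd isT); rewrite ltr_norml => /andP[+ _].
  by rewrite ltrNl opprB ltrD2r ltNge Mt.
by rewrite gerDl leNgt d0.
Qed.
End Barrier.

(** * Dissipative couplings *)

Section Sums.
Variables (R : comPzRingType) (N : nat).
Implicit Types v f : 'I_N -> R.

Lemma sum_sum_mul v f : \sum_i \sum_j v i * f j = (\sum_i v i) * (\sum_j f j).
Proof. by rewrite big_distrl /=; apply: eq_bigr => i _; rewrite big_distrr. Qed.

(** A covariance identity: when [v] or [f] has sum zero, the double sum over differences reduces to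
    a single sum of products. *)
Lemma sum_sum_diff v f : \sum_i \sum_j (v j - v i) * (f j - f i) =
  2 * N%:R * (\sum_i v i * f i) - 2 * (\sum_i v i) * (\sum_i f i).
Proof.
have -> : \sum_i \sum_j (v j - v i) * (f j - f i) =
    (\sum_i \sum_(j < N) v i * f i + \sum_(i < N) \sum_j v j * f j)
    - (\sum_i \sum_j v i * f j + \sum_i \sum_j v j * f i).
  rewrite -!big_split -sumrB /=; apply: eq_bigr => i _.
  rewrite -!big_split -sumrB /=; apply: eq_bigr => j _; ring.
rewrite [\sum_i \sum_j v j * f i]exchange_big /= !sum_sum_mul.
have -> : \sum_i \sum_(j < N) v i * f i = N%:R * \sum_i v i * f i.
  rewrite big_distrr /=; apply: eq_bigr => i _.
  by rewrite sumr_const card_ord mulr_natl.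
by rewrite sumr_const card_ord -mulr_natl; ring.
Qed.

(** Exchanging the indices shows that the sum equals its opposite. The factor 2 stays because it
    cannot be cancelled in a general ring. *)
Lemma sum_antisym (g : 'I_N -> 'I_N -> R) : (forall i j, g j i = - g i j) ->
  2 * (\sum_i \sum_j g i j) = 0.
Proof.
move=> ga; set S := \sum_i _.
have SN : S = - S.
  rewrite {1}/S exchange_big /S /= -sumrN; apply: eq_bigr => i _.
  by rewrite -sumrN; apply: eq_bigr => j _.
by rewrite mulr2n mulrDl mul1r {1}SN addNr.
Qed.
End Sums.

(** * Asymptotic stability from an odd dissipative coupling *)

Section Stability.
Variables (R : realType) (N : nat).
Hypothesis N0 : (0 < N)%N.
Variables (F : 'rV[R]_N -> 'rV[R]_N) (p : 'rV[R]_N).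
Variable h : 'I_N -> 'I_N -> R -> R.
Implicit Types v : 'rV[R]_N.
Hypothesis FE : forall v i,
  F (p + v) 0 i = N%:R^-1 * \sum_j h i j (v 0 j - v 0 i).
Hypothesis h_anti : forall i j z, h j i (- z) = - h i j z.
Variables (d c : R).
Hypotheses (d0 : 0 < d) (c0 : 0 < c).
Hypothesis dissipative : forall v : 'rV[R]_N,
  (forall i j, `|v 0 j - v 0 i| < d) ->
  c * (\sum_i \sum_j (v 0 j - v 0 i) ^+ 2) <=
  \sum_i \sum_j (v 0 j - v 0 i) * h i j (v 0 j - v 0 i).

(** The Lyapunov function. It vanishes exactly on constant vectors and so measures the deviation
    modulo a global phase shift. *)
Definition spread (v : 'rV[R]_N) : R := \sum_i \sum_j (v 0 j - v 0 i) ^+ 2.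

Lemma spread_ge0 v : 0 <= spread v.
Proof. by apply: sumr_ge0 => i _; apply: sumr_ge0 => j _; exact: sqr_ge0. Qed.

Lemma spread_lt v (e : R) : 0 < e -> spread v < e ^+ 2 ->
  forall i j, `|v 0 j - v 0 i| < e.
Proof.
move=> e0 ve i j; rewrite -(ltr_pXn2r (n := 2)) ?nnegrE // ?ltW //.
rewrite real_normK ?num_real //; apply: le_lt_trans ve.
rewrite /spread (bigD1 i) //= (bigD1 j) //= -addrA lerDl addr_ge0 //.
  by apply: sumr_ge0 => k _; exact: sqr_ge0.
by apply: sumr_ge0 => k _; apply: sumr_ge0 => l _; exact: sqr_ge0.
Qed.

Lemma spread_continuous : continuous spread.
Proof.
apply: continuous_bigsum => i; apply: continuous_bigsum => j v.
have cij : {for v, continuous (fun v : 'rV[R]_N => v 0 j - v 0 i)}.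
  exact: (continuousB (@coord_continuous R 1 N 0 j v) (@coord_continuous R 1 N 0 i v)).
exact: (continuousM cij cij).
Qed.

Lemma coord_sub_continuous i : continuous (fun v => (v - p) 0 i).
Proof.
rewrite (_ : (fun v => _) = (fun v : 'rV[R]_N => v 0 i - p 0 i)); last first.
  by apply: funext => v; rewrite !mxE.
move=> v; apply: (continuousB (@coord_continuous R 1 N 0 i v)).
exact: cst_continuous.
Qed.

Lemma spread_sub_continuous : continuous (fun v => spread (v - p)).
Proof.
rewrite (_ : (fun v => _) =
    (fun v => \sum_i \sum_j ((v - p) 0 j - (v - p) 0 i) ^+ 2)) //.
apply: continuous_bigsum => i; apply: continuous_bigsum => j v.
have cij := continuousB (@coord_sub_continuous j v) (@coord_sub_continuous i v).
exact: (continuousM cij cij).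
Qed.

(** Action equals reaction: the terms for [(i, j)] and [(j, i)] cancel by [h_anti]. Hence the sum of
    the phases is conserved. *)
Lemma field_sum0 v : \sum_i F (p + v) 0 i = 0.
Proof.
under eq_bigr do rewrite FE.
rewrite -big_distrr /=.
have ga i j : h j i (v 0 i - v 0 j) = - h i j (v 0 j - v 0 i).
  by rewrite -h_anti opprB.
have /eqP := sum_antisym ga.
by rewrite mulf_eq0 pnatr_eq0 => /eqP ->; rewrite mulr0.
Qed.

(** The left-hand side is the derivative of [spread] along the field. As the field has sum zero, it
    reduces to the pairing of [v] with the field, which is then symmetrized in the two indices. *)
Lemma spread_deriv v :
  \sum_i \sum_j 2 * ((v 0 j - v 0 i) * (F (p + v) 0 j - F (p + v) 0 i)) =
  - 2 * \sum_i \sum_j (v 0 j - v 0 i) * h i j (v 0 j - v 0 i).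
Proof.
have N1 : N%:R != 0 :> R by rewrite pnatr_eq0 -lt0n.
under eq_bigr do rewrite -big_distrr /=.
rewrite -big_distrr /= sum_sum_diff field_sum0 mulr0 subr0.
set S := (X in _ = _ * X).
have -> : \sum_i v 0 i * F (p + v) 0 i =
    N%:R^-1 * \sum_i \sum_j v 0 i * h i j (v 0 j - v 0 i).
  rewrite big_distrr /=; apply: eq_bigr => i _.
  by rewrite FE mulrCA; congr (_ * _); rewrite big_distrr.
set A := \sum_i \sum_j v 0 i * _.
have -> : S = - A - A.
  rewrite {2}/A exchange_big /= /S /A -sumrN -sumrB; apply: eq_bigr => i _.
  rewrite -sumrN -sumrB; apply: eq_bigr => j _.
  by rewrite -[v 0 i - v 0 j]opprB h_anti; ring.
by field.
Qed.

Section Along.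
Variable x : R -> 'rV[R]_N.
Hypothesis sol : forward_solution F x.

Let W t := spread (x t - p).

Lemma spread_along_cont : {within `[0, +oo[, continuous W}.
Proof.
move=> t; apply: (@continuous_comp _ _ _ (x : subspace _ -> _) (fun v => spread (v - p))).
  by case: sol => cx _; exact: cx.
exact: spread_sub_continuous.
Qed.

Lemma spread_along_deriv (t : R) : 0 < t -> is_derive t 1 W
  (- 2 * \sum_i \sum_j ((x t - p) 0 j - (x t - p) 0 i) *
     h i j ((x t - p) 0 j - (x t - p) 0 i)).
Proof.
move=> t0; rewrite -spread_deriv subrKC.
case: sol => _ /(_ t t0) /is_derive_rowP dx.
have dz i j : is_derive t 1 (fun s => (x s - p) 0 j - (x s - p) 0 i)
    (F (x t) 0 j - F (x t) 0 i).
  rewrite (_ : (fun s => _) = (fun s => x s 0 j) - (fun s => x s 0 i)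
     + cst (p 0 i - p 0 j)); last first.
    by apply: funext => s; rewrite !fctE !mxE; ring.
  have h1 := dx i; have h2 := dx j.
  by apply: is_derive_eq; rewrite addr0.
rewrite (_ : W = \sum_i \sum_j (fun s => (x s - p) 0 j - (x s - p) 0 i) ^+ 2); last first.
  apply: funext => s; rewrite /W /spread fct_sumE; apply: eq_bigr => i _.
  by rewrite fct_sumE.
apply: is_derive_sum => i; apply: is_derive_sum => j.
have h1 := dz i j; apply: is_derive_eq.
by rewrite expr1 [RHS]mulrA.
Qed.

Lemma spread_deriv_le (t : R) : W t < d ^+ 2 ->
  - 2 * \sum_i \sum_j ((x t - p) 0 j - (x t - p) 0 i) *
     h i j ((x t - p) 0 j - (x t - p) 0 i) <= - 2 * c * W t.
Proof.
move=> Wd; rewrite -mulrA !mulNr lerN2 ler_pM2l //.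
exact: dissipative (spread_lt d0 Wd).
Qed.

(** Below [d ^+ 2] every phase difference is below [d], where dissipativity makes [W] nonincreasing;
    the barrier argument makes this self-sustaining. *)
Lemma spread_along_lt M : M <= d ^+ 2 -> W 0 < M -> forall t, 0 <= t -> W t < M.
Proof.
move=> Md W0; apply: (barrier spread_along_cont spread_along_deriv) => // t t0 WM.
apply: le_trans (spread_deriv_le (lt_le_trans WM Md)) _.
by rewrite mulNr mulNr oppr_le0 !mulr_ge0 ?spread_ge0 // ltW.
Qed.

Lemma sum_along_const (t : R) : 0 <= t -> \sum_i (x t - p) 0 i = \sum_i (x 0 - p) 0 i.
Proof.
move=> t0; case: sol => cx dx.
pose S s := \sum_i (x s - p) 0 i.
have cS : {within `[0, +oo[, continuous S}.
  apply: continuous_bigsum => i s.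
  apply: (@continuous_comp _ _ _ (x : subspace _ -> _) (fun v => (v - p) 0 i)).
    exact: cx.
  exact: coord_sub_continuous.
have dS (s : R) : 0 < s -> is_derive s 1 S 0.
  move=> s0; rewrite -(field_sum0 (x s - p)) subrKC.
  rewrite (_ : S = \sum_i (fun r => (x r - p) 0 i)); last first.
    by apply: funext => r; rewrite fct_sumE.
  apply: is_derive_sum => i.
  rewrite (_ : (fun r => _) = (fun r => x r 0 i) - cst (p 0 i)); last first.
    by apply: funext => r; rewrite !fctE !mxE.
  have h1 := (is_derive_rowP _ _ _).1 (dx s s0) i.
  by apply: is_derive_eq; rewrite subr0.
apply: le_anti; apply/andP; split.
  apply: (deriv_le_nonincreasing (f := S) (df := cst 0)) => // s /andP[s0 _].
  by split; [exact: dS|].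
rewrite -lerN2.
apply: (deriv_le_nonincreasing (f := - S) (df := cst 0)) => //.
  by move=> s; apply: cvgN; exact: cS.
move=> s /andP[s0 _]; split => //.
by have h1 := dS s s0; apply: is_derive_eq; rewrite oppr0.
Qed.

(** If [W t] were at least [e], monotonicity would keep [W] at least [e] up to time [t], so it would
    fall at rate at least [2 * c * e] and be negative at [t]. *)
Lemma spread_along_decay e : 0 < e -> W 0 < d ^+ 2 ->
  forall t : R, 0 <= t -> W 0 / (2 * c * e) < t -> W t < e.
Proof.
move=> e0 W0 t t0 tbig; rewrite ltNge; apply/negP => We.
have ce : 0 < 2 * c * e by rewrite !mulr_gt0.
have Wd s : 0 <= s -> W s < d ^+ 2 by exact: spread_along_lt.
have mono (a b : R) : 0 <= a -> a <= b -> W b <= W a.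
  move=> a0 ab; apply: (deriv_le_nonincreasing a0 ab spread_along_cont) => s /andP[as_ _].
  have s0 := le_lt_trans a0 as_.
  split; first exact: spread_along_deriv.
  apply: le_trans (spread_deriv_le (Wd s (ltW s0))) _.
  by rewrite mulNr mulNr oppr_le0 !mulr_ge0 ?spread_ge0 // ltW.
have : (W + (2 * c * e) *: @idfun R) t <= (W + (2 * c * e) *: @idfun R) 0.
  apply: (deriv_le_nonincreasing (lexx 0) t0 (df := fun s =>
    - 2 * \sum_i \sum_j ((x s - p) 0 j - (x s - p) 0 i) *
     h i j ((x s - p) 0 j - (x s - p) 0 i) + 2 * c * e)).
    move=> s; apply: (@cvgD _ _ (subspace _)); first exact: spread_along_cont.
    apply: continuous_subspaceT => r; apply: cvgZr; exact: cvg_id.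
  move=> s /andP[s0 st]; split.
    have h1 := spread_along_deriv s0.
    rewrite -[X in is_derive _ _ _ (_ + X)]mulr1.
    exact: (is_deriveD h1 (is_deriveZ (2 * c * e) (is_derive_id s 1))).
  have := spread_deriv_le (Wd s (ltW s0)).
  have : 2 * c * e <= 2 * c * W s.
    by rewrite ler_pM2l ?mulr_gt0 // (le_trans We) // mono // ltW.
  by rewrite !mulNr; lra.
rewrite !fctE /GRing.scale /= mulr0 addr0.
move: tbig; rewrite ltr_pdivrMr // mulrC => tbig.
by have := spread_ge0 (x t - p); rewrite -/(W t); lra.
Qed.
End Along.

Lemma spread_small e : 0 < e -> exists2 r, 0 < r & forall v, `|v| < r -> spread v < e.
Proof.
move=> e0; have /cvgrPdist_lt /(_ e e0) := @spread_continuous 0.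
move=> /nbhs_ballP [r /= r0 hr]; exists r => // v vr.
have s0 : spread 0 = 0.
  by rewrite /spread big1 // => i _; rewrite big1 // => j _; rewrite !mxE subrr expr0n.
have : ball (0 : 'rV[R]_N) r v by rewrite -ball_normE /= sub0r normrN.
move=> /hr /=.
by rewrite s0 sub0r normrN ger0_norm ?spread_ge0.
Qed.

Theorem dissipative_asymptotically_stable : asymptotically_stable_mod_shift F p.
Proof.
split.
- move=> e e0.
  have e3 : 0 < e / 3 by rewrite divr_gt0.
  pose M := Num.min (d ^+ 2) ((e / 3) ^+ 2).
  have M0 : 0 < M by rewrite lt_min !exprn_gt0.
  have [r r0 hr] := spread_small M0.
  exists (Num.min r (e / 3)); first by rewrite lt_min r0.
  move=> x sol; rewrite lt_min => /andP[xr xe] t t0.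
  have Md : M <= d ^+ 2 by rewrite ge_min lexx.
  have WM := spread_along_lt sol Md (hr _ xr) t0.
  have We : spread (x t - p) < (e / 3) ^+ 2.
    by apply: lt_le_trans WM _; rewrite ge_min lexx orbT.
  have zs := spread_lt e3 We.
  apply/row_norm_ltP => // i.
  have Np : 0 < N%:R :> R by rewrite ltr0n.
  rewrite -(ltr_pM2l Np) -[N%:R in ltLHS]ger0_norm ?ltW // -normrM.
  (* A coordinate is recovered from its differences to the others and from the conserved sum. Each
     of the [N] differences and each of the [N] initial deviations is at most [e / 3]. *)
  have -> : N%:R * (x t - p) 0 i =
      \sum_j ((x t - p) 0 i - (x t - p) 0 j) + \sum_j (x 0 - p) 0 j.
    rewrite sumrB (sum_along_const sol t0) sumr_const card_ord.
    by rewrite mulr_natl subrK.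
  rewrite -big_split /=.
  apply: le_lt_trans (ler_norm_sum _ _ _) _.
  apply: (@le_lt_trans _ _ (\sum_(j < N) (e / 3 + e / 3))).
    apply: ler_sum => j _; apply: le_trans (ler_normD _ _) _.
    apply: lerD; apply: ltW; first exact: zs.
    by move: j; apply/row_norm_ltP.
  rewrite sumr_const card_ord -[ltLHS]mulr_natl ltr_pM2l //; lra.
- have [r r0 hr] := spread_small (exprn_gt0 2 d0).
  exists r => // x sol xr e e0.
  (* The shift is the deviation of the first oscillator; the remaining distance then consists of
     phase differences, which [spread] controls. *)
  near=> t; exists ((x t - p) 0 (Ordinal N0)).
  have t0 : 0 <= t by near: t; by apply: nbhs_pinfty_ge; rewrite ?num_real.
  have := spread_along_decay sol (exprn_gt0 2 e0) (hr _ xr) t0.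
  have tb : spread (x 0 - p) / (2 * c * e ^+ 2) < t.
    by near: t; by apply: nbhs_pinfty_gt; rewrite ?num_real.
  move=> /(_ tb) /(spread_lt e0) zs.
  apply/row_norm_ltP => // i; apply: le_lt_trans (zs (Ordinal N0) i).
  by rewrite !mxE opprD addrA.
Unshelve. all: by end_near. Qed.
End Stability.

(** * Growth in the three-group reduction *)

Section Coupling.
Variable R : realType.
Implicit Types k eps z : R.

Definition coupling k eps z : R := k * sin z + eps * sin (2 * z).

Lemma couplingN k eps z : coupling k eps (- z) = - coupling k eps z.
Proof. by rewrite /coupling mulrN !sinN; ring. Qed.

Lemma coupling_lipschitz k eps (u v : R) : 0 <= eps ->
  `|coupling k eps u - coupling k eps v| <= (`|k| + 2 * eps) * `|u - v|.
Proof.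
move=> e0; rewrite /coupling.
have -> : k * sin u + eps * sin (2 * u) - (k * sin v + eps * sin (2 * v)) =
  k * (sin u - sin v) + eps * (sin (2 * u) - sin (2 * v)) by ring.
apply: le_trans (ler_normD _ _) _; rewrite !normrM [leRHS]mulrDl.
apply: lerD; first by rewrite ler_wpM2l // sin_lipschitz.
rewrite (ger0_norm e0) [2 * eps]mulrC -mulrA ler_wpM2l //.
apply: le_trans (sin_lipschitz _ _) _.
by rewrite -mulrBr normrM ger0_norm.
Qed.

(** The radius is uniform over [|k| <= K], so it serves all pairs of oscillators at once. It is
    halved because the second harmonic evaluates the sine at [2 * z]. *)
Lemma coupling_near0 K eps (r : R) : 0 <= eps -> 0 <= K -> 0 < r ->
  exists2 d : R, 0 < d & forall k z, `|k| <= K -> `|z| < d ->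
    `|coupling k eps z - (k + 2 * eps) * z| <= r * `|z|.
Proof.
move=> e0 K0 r0.
have D0 : 0 < K + 2 * eps + 1 by lra.
have [d d0 dP] := sin_near0 (divr_gt0 r0 D0).
exists (d / 2); first by rewrite divr_gt0.
move=> k z kK zd.
have z2 : `|2 * z| = 2 * `|z| by rewrite normrM ger0_norm.
have h1 := dP z; have h2 := dP (2 * z).
have {}h1 : `|sin z - z| <= r / (K + 2 * eps + 1) * `|z|.
  by apply: h1; apply: lt_le_trans zd _; rewrite ler_pdivrMr // ler_pMr //; lra.
have {}h2 : `|sin (2 * z) - 2 * z| <= r / (K + 2 * eps + 1) * (2 * `|z|).
  by rewrite -z2; apply: h2; rewrite z2 mulrC -ltr_pdivlMr.
have -> : coupling k eps z - (k + 2 * eps) * z =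
  k * (sin z - z) + eps * (sin (2 * z) - 2 * z) by rewrite /coupling; ring.
set q := r / _ in h1 h2.
have q0 : 0 <= q by rewrite divr_ge0 // ltW.
apply: le_trans (ler_normD _ _) _; rewrite !normrM (ger0_norm e0).
apply: (@le_trans _ _ (K * (q * `|z|) + eps * (q * (2 * `|z|)))).
  by apply: lerD; [exact: ler_pM | exact: ler_wpM2l].
have -> : r = q * (K + 2 * eps + 1) by rewrite divfK // gt_eqF.
have : 0 <= q * `|z| by rewrite mulr_ge0.
by lra.
Qed.
End Coupling.

(* [al], [be], [ga] are the phases of three groups of sizes [p], [q], [r];
   [al - be] spans the unstable direction of the linearization and
   [p * al + q * be - (p + q) * ga] a stable one. *)
Lemma reduced_growth (R : realType) (p q r n eps : R) :
  1 <= p -> 1 <= q -> 0 <= r -> n = p + q + r -> 0 < eps ->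
  2 * eps * n < p + q - r ->
  exists2 d : R, 0 < d & exists2 c : R, 0 < c &
  forall al be ga : R, `|al - be| < d -> `|al - ga| < d -> `|be - ga| < d ->
  let f := coupling (-1) eps in let g := coupling 1 eps in
  let dal := n^-1 * (q * f (be - al) + r * g (ga - al)) in
  let dbe := n^-1 * (p * f (al - be) + r * g (ga - be)) in
  let dga := n^-1 * (p * g (al - ga) + q * g (be - ga)) in
  let x := al - be in let z := p * al + q * be - (p + q) * ga in
  is_true (c * (x ^+ 2 + z ^+ 2) <=
    2 * (x * (dal - dbe)) - 2 * (z * (p * dal + q * dbe - (p + q) * dga))).
Proof.
move=> p1 q1 r0 nE eps0 small.
have n1 : 1 <= n by lra.
have n0 : 0 < n by lra.
(* In the linearization [x] grows at rate [kap / n] and [z] decays at rate [1 + 2 * eps]. *)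
pose kap := (p + q - r) - 2 * eps * n.
have kap0 : 0 < kap by rewrite subr_gt0.
pose mu := Num.min kap n.
have mu0 : 0 < mu by rewrite lt_min kap0.
(* With this tolerance the nonlinear terms, at most [3 * n ^+ 2 * rho * S ^+ 2], use up half of the
   main term [mu * (x ^+ 2 + z ^+ 2)]. *)
pose rho := mu / (12 * n ^+ 2).
have rho0 : 0 < rho by rewrite divr_gt0 // mulr_gt0 // exprn_gt0.
have [d d0 dP] := coupling_near0 (ltW eps0) ler01 rho0.
exists d => //; exists (mu / n); first by rewrite divr_gt0.
move=> al be ga xd ad bd f g dal dbe dga x z.
pose a := al - ga; pose b := be - ga.
pose ef := f x - (-1 + 2 * eps) * x.
pose ea := g a - (1 + 2 * eps) * a.
pose eb := g b - (1 + 2 * eps) * b.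
have hf : `|ef| <= rho * `|x| by apply: dP => //; rewrite normrN1.
have ha : `|ea| <= rho * `|a| by apply: dP => //; rewrite normr1.
have hb : `|eb| <= rho * `|b| by apply: dP => //; rewrite normr1.
(* The quadratic part is diagonal in [x] and [z]; the bracket collects the deviations of the
   couplings from their linear parts. *)
have E : n * (x * (dal - dbe) - z * (p * dal + q * dbe - (p + q) * dga)) =
    kap * x ^+ 2 + n * (1 + 2 * eps) * z ^+ 2
    - (x * ((p + q) * ef + r * (ea - eb)) - n * (z * (p * ea + q * eb))).
  have fx : f (be - al) = - f x by rewrite -couplingN opprB.
  have ga' : g (ga - al) = - g a by rewrite -couplingN opprB.
  have gb' : g (ga - be) = - g b by rewrite -couplingN opprB.
  rewrite /ef /ea /eb /dal /dbe /dga fx ga' gb' -/x -/a -/b.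
  move: (f x) (g a) (g b) => fx0 ga0 gb0.
  rewrite /kap /x /z /a /b; move: n0; rewrite nE => n0; field.
  by rewrite gt_eqF.
pose S := `|x| + `|z|.
have x0 := normr_ge0 x; have z0 := normr_ge0 z.
have pq0 : 0 < p + q by lra.
have pz : `|z| <= (p + q) * `|z| by rewrite ler_peMl //; lra.
have qx : q * `|x| <= (p + q) * `|x| by rewrite ler_wpM2r //; lra.
have px : p * `|x| <= (p + q) * `|x| by rewrite ler_wpM2r //; lra.
have aS : `|a| <= S.
  rewrite -(ler_pM2l pq0) -[p + q in leLHS]gtr0_norm // -normrM.
  have -> : (p + q) * a = z + q * x by rewrite /a /z /x; ring.
  apply: le_trans (ler_normD _ _) _; rewrite normrM (ger0_norm (x := q)) /S; lra.
have bS : `|b| <= S.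
  rewrite -(ler_pM2l pq0) -[p + q in leLHS]gtr0_norm // -normrM.
  have -> : (p + q) * b = z - p * x by rewrite /b /z /x; ring.
  apply: le_trans (ler_normB _ _) _; rewrite normrM (ger0_norm (x := p)) /S; lra.
have S0 : 0 <= S by rewrite addr_ge0.
have {}ha : `|ea| <= rho * S by apply: le_trans ha _; rewrite ler_wpM2l // ltW.
have {}hb : `|eb| <= rho * S by apply: le_trans hb _; rewrite ler_wpM2l // ltW.
have {}hf : `|ef| <= rho * S.
  by apply: le_trans hf _; apply: ler_wpM2l; [exact: ltW | rewrite lerDl].
have rS : 0 <= rho * S by rewrite mulr_ge0 // ltW.
have B1 : `|x * ((p + q) * ef + r * (ea - eb))| <= `|x| * (2 * n * (rho * S)).
  rewrite normrM ler_wpM2l //.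
  apply: le_trans (ler_normD _ _) _; rewrite !normrM (gtr0_norm pq0) (ger0_norm r0).
  have h1 : (p + q) * `|ef| <= (p + q) * (rho * S) by rewrite ler_wpM2l // ltW.
  have h2 : r * `|ea - eb| <= r * (2 * (rho * S)).
    by rewrite ler_wpM2l //; apply: le_trans (ler_normB _ _) _; lra.
  have h3 : 0 <= (p + q) * (rho * S) by rewrite mulr_ge0 // ltW.
  apply: le_trans (lerD h1 h2) _; rewrite nE; lra.
have B2 : `|n * (z * (p * ea + q * eb))| <= `|z| * (n ^+ 2 * (rho * S)).
  rewrite !normrM (gtr0_norm n0) mulrCA.
  apply: ler_wpM2l => //; rewrite expr2 -mulrA.
  apply: ler_wpM2l; first exact: ltW.
  apply: le_trans (ler_normD _ _) _; rewrite !normrM.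
  rewrite (ger0_norm (x := p)) ?(ger0_norm (x := q)); try lra.
  have h1 : p * `|ea| <= p * (rho * S) by rewrite ler_wpM2l //; lra.
  have h2 : q * `|eb| <= q * (rho * S) by rewrite ler_wpM2l //; lra.
  have h3 : 0 <= r * (rho * S) by rewrite mulr_ge0.
  apply: le_trans (lerD h1 h2) _; rewrite nE; lra.
have nn : n <= n ^+ 2 by rewrite expr2 ler_peMr // ltW.
have B3 : 3 * n ^+ 2 * rho * S ^+ 2 <= mu / 2 * (x ^+ 2 + z ^+ 2).
  have -> : 3 * n ^+ 2 * rho = mu / 4 by rewrite /rho; field; rewrite gt_eqF.
  have : S ^+ 2 <= 2 * (x ^+ 2 + z ^+ 2).
    have := sqr_ge0 (`|x| - `|z|).
    rewrite sqrrB sqrrD -!normrX !(ger0_norm (sqr_ge0 _)); lra.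
  by move=> h; have := ler_wpM2l (ltW mu0) h; lra.
have x2 := sqr_ge0 x; have z2 := sqr_ge0 z.
have B0 : mu * (x ^+ 2 + z ^+ 2) <= kap * x ^+ 2 + n * (1 + 2 * eps) * z ^+ 2.
  have h1 : mu * x ^+ 2 <= kap * x ^+ 2 by rewrite ler_wpM2r // ge_min lexx.
  have h2 : mu * z ^+ 2 <= n * z ^+ 2 by rewrite ler_wpM2r // ge_min lexx orbT.
  have h3 : 0 <= n * eps * z ^+ 2 by apply: mulr_ge0 z2; apply: mulr_ge0; exact: ltW.
  lra.
have B4 : x * ((p + q) * ef + r * (ea - eb)) - n * (z * (p * ea + q * eb))
    <= 3 * n ^+ 2 * rho * S ^+ 2.
  apply: le_trans (ler_norm _) _; apply: le_trans (ler_normB _ _) _.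
  apply: le_trans (lerD B1 B2) _.
  have h1 : n * (`|x| * (rho * S)) <= n ^+ 2 * (`|x| * (rho * S)).
    by rewrite ler_wpM2r // mulr_ge0.
  have h2 : 0 <= n ^+ 2 * (`|x| * (rho * S)).
    by apply: mulr_ge0 (sqr_ge0 _) (mulr_ge0 x0 rS).
  have h3 : 0 <= n ^+ 2 * (`|z| * (rho * S)).
    by apply: mulr_ge0 (sqr_ge0 _) (mulr_ge0 z0 rS).
  have -> : S ^+ 2 = S * (`|x| + `|z|) by rewrite expr2.
  lra.
have mun : n * (mu / n * (x ^+ 2 + z ^+ 2)) = mu * (x ^+ 2 + z ^+ 2).
  by field; rewrite gt_eqF.
rewrite -(ler_pM2l n0) mun.
move: E; move: (x * (dal - dbe)) (z * (p * dal + q * dbe - (p + q) * dga)) => U V E.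
lra.
Qed.

Lemma is_derive_lincomb3 (R : realType) (f g h : R -> R) (t df dg dh k l m : R) :
  is_derive t 1 f df -> is_derive t 1 g dg -> is_derive t 1 h dh ->
  is_derive t 1 (k *: f + l *: g - m *: h) (k * df + l * dg - m * dh).
Proof.
move=> f1 g1 h1.
exact: (is_deriveB (is_deriveD (is_deriveZ k f1) (is_deriveZ l g1)) (is_deriveZ m h1)).
Qed.

Lemma is_derive_sqrB (R : realType) (f g : R -> R) (t df dg : R) :
  is_derive t 1 f df -> is_derive t 1 g dg ->
  is_derive t 1 (f ^+ 2 - g ^+ 2) (2 * (f t * df) - 2 * (g t * dg)).
Proof.
by move=> f1 g1; apply: is_derive_eq; rewrite !expr1 !mulrA.
Qed.

(** * Instability through the three-group invariant space *)

Section Instability.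
Variables (R : realType) (N : nat).
Variables (F : 'rV[R]_N -> 'rV[R]_N) (p : 'rV[R]_N).
Variable cl : 'I_N -> option bool.
Variable eps : R.
Hypothesis eps0 : 0 < eps.

(* [Some true] and [Some false] label the two halves of the majority class,
   [None] the minority class. *)
Definition group_sign (l l' : option bool) : R :=
  if isSome l && isSome l' then -1 else 1.

Definition group_field (y : option bool -> R) (l : option bool) : R :=
  N%:R^-1 * \sum_j coupling (group_sign l (cl j)) eps (y (cl j) - y l).

Definition group_size (l : option bool) : R := #|[pred j | cl j == l]|%:R.

Hypothesis FE : forall y i,
  F (p + \row_j y (cl j)) 0 i = group_field y (cl i).
Hypothesis cl_onto : forall l, exists i, cl i = l.
Hypothesis small :
  2 * eps * N%:R < group_size (Some true) + group_size (Some false) - group_size None.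

Lemma group_sum (f : option bool -> R) : \sum_j f (cl j) =
  group_size (Some true) * f (Some true) + group_size (Some false) * f (Some false)
  + group_size None * f None.
Proof.
rewrite (partition_big cl predT) //=.
rewrite (bigD1 (Some true)) //= (bigD1 (Some false)) //= (bigD1 None) //=.
have S l : \sum_(j | cl j == l) f (cl j) = group_size l * f l.
  rewrite (eq_bigr (fun=> f l)) => [|j /eqP -> //].
  by rewrite sumr_const /group_size mulr_natl.
by rewrite !S big1 ?addr0 ?addrA // => -[[]|].
Qed.

Lemma group_sizeD :
  N%:R = group_size (Some true) + group_size (Some false) + group_size None.
Proof.
have := group_sum (fun=> 1); rewrite !mulr1 => <-.
by rewrite sumr_const card_ord.
Qed.

Lemma group_size_ge1 l : 1 <= group_size l.
Proof.
have [i il] := cl_onto l; rewrite /group_size ler1n.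
by apply/card_gt0P; exists i; rewrite inE il.
Qed.

Lemma coupling0 k : coupling k eps 0 = 0.
Proof. by rewrite /coupling mulr0 sin0 !mulr0 addr0. Qed.

(** Each coupling has Lipschitz constant at most [1 + 2 * eps], and a phase difference changes by at
    most [2 * d]. The bound is global, as Picard iteration on the half-line requires. *)
Lemma group_field_lipschitz (u v : option bool -> R) (d : R) :
  (forall l, `|u l - v l| <= d) -> forall l,
  `|group_field u l - group_field v l| <= (2 * (1 + 2 * eps)) * d.
Proof.
move=> uv l; rewrite /group_field -mulrBr -sumrB normrM.
have N0 : 0 < N%:R :> R.
  by rewrite group_sizeD; move: (group_size_ge1 None) (group_size_ge1 (Some true))
    (group_size_ge1 (Some false)); lra.
rewrite gtr0_norm ?invr_gt0 // ler_pdivrMl //.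
apply: le_trans (ler_norm_sum _ _ _) _.
apply: (@le_trans _ _ (\sum_(j < N) 2 * (1 + 2 * eps) * d)); last first.
  by rewrite sumr_const card_ord [leRHS]mulr_natl.
apply: ler_sum => j _.
apply: le_trans (coupling_lipschitz _ _ _ (ltW eps0)) _.
have -> : `|group_sign l (cl j)| = 1.
  by rewrite /group_sign; case: ifP; rewrite ?normrN1 ?normr1.
rewrite [2 * (1 + _)]mulrC -mulrA ler_pM2l; last by move: eps0; lra.
have -> : u (cl j) - u l - (v (cl j) - v l) = (u (cl j) - v (cl j)) - (u l - v l).
  by ring.
by apply: le_trans (ler_normB _ _) _; rewrite mulr2n mulrDl mul1r lerD.
Qed.

(** Stability only speaks about given solutions, so refuting it needs one to exist: a solution of
    the three-phase system is lifted to the network through [cl]. *)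
Lemma group_field_solution (u0 : option bool -> R) : exists y : option bool -> R -> R,
  [/\ forall l, y l 0 = u0 l,
   forall l (t : R), 0 < t -> is_derive t 1 (y l) (group_field (y ^~ t) l),
   forall l, continuous (y l) &
   forward_solution F (fun t => p + \row_j y (cl j) t)].
Proof.
have L0 : 0 < 2 * (1 + 2 * eps) by move: eps0; lra.
have [y [cy y0 dy]] := picard_lindelof L0 group_field_lipschitz u0.
exists y; split => //; split.
  apply: continuous_subspaceT; apply: continuous_rowP => i.
  rewrite (_ : (fun s => _) = cst (p 0 i) + y (cl i)).
    by move=> t; apply: cvgD; [exact: cvg_cst | exact: cy].
  by apply: funext => s; rewrite !mxE.
move=> t t0; apply/is_derive_rowP => i.
rewrite (FE (y ^~ t)) (_ : (fun s => _) = cst (p 0 i) + y (cl i)).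
  have h := dy (cl i) t t0.
  by apply: is_derive_eq; rewrite add0r.
by apply: funext => s; rewrite !mxE.
Qed.

(** Stability would keep [V = x ^+ 2 - z ^+ 2] below [d ^+ 2] for all time, whereas [V] starts
    positive and its derivative is at least [c * V 0]. *)
Theorem group_unstable : unstable F p.
Proof.
have := small; set P := group_size (Some true); set Q := group_size (Some false).
set S := group_size None => smallPQS.
have P1 : 1 <= P := group_size_ge1 _.
have Q1 : 1 <= Q := group_size_ge1 _.
have S0 : 0 <= S by apply: le_trans (group_size_ge1 _).
have NE : N%:R = P + Q + S := group_sizeD.
have [d d0 [c c0 growth]] := reduced_growth P1 Q1 S0 NE eps0 smallPQS.
move=> stab.
have d20 : 0 < d / 2 by rewrite divr_gt0.
have [d1 d10 st] := stab _ d20.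
have N0 : 0 < N%:R :> R by rewrite NE; lra.
pose k := d1 / (2 * N%:R).
have k0 : 0 < k by rewrite divr_gt0 // mulr_gt0.
have Nk : N%:R * k = d1 / 2 by rewrite /k; field; rewrite gt_eqF.
(* These values give [z = 0] and [x = (P + Q) * k > 0] at time 0; the choice of [k] bounds each of
   them by [d1 / 2]. *)
pose u0 (l : option bool) : R :=
  match l with Some true => Q * k | Some false => - (P * k) | None => 0 end.
have [y [y0 dy cy sol]] := group_field_solution u0.
have start : `|p + \row_j y (cl j) 0 - p| < d1.
  rewrite addrC addKr; apply/row_norm_ltP => // i; rewrite mxE y0.
  have Pk : P * k <= N%:R * k by rewrite ler_pM2r // NE; lra.
  have Qk : Q * k <= N%:R * k by rewrite ler_pM2r // NE; lra.
  rewrite /u0; case: (cl i) => [[]|]; rewrite ?normrN ?normr0 //.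
    rewrite ger0_norm; [lra|by apply: mulr_ge0; lra].
  rewrite ger0_norm; [lra|by apply: mulr_ge0; lra].
have yd l t : 0 <= t -> `|y l t| < d / 2.
  move=> t0; have := st _ sol start t t0; rewrite addrC addKr.
  have [i <-] := cl_onto l.
  by move=> /(row_norm_ltP _ d20) /(_ i); rewrite mxE.
have yyd l l' t : 0 <= t -> `|y l t - y l' t| < d.
  move=> t0; apply: le_lt_trans (ler_normB _ _) _.
  by have := yd l t t0; have := yd l' t t0; lra.
pose x : R -> R := y (Some true) - y (Some false).
pose z : R -> R := P *: y (Some true) + Q *: y (Some false) - (P + Q) *: y None.
pose V : R -> R := x ^+ 2 - z ^+ 2.
pose D l t := group_field (y ^~ t) l.
pose dV t := 2 * (x t * (D (Some true) t - D (Some false) t))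
  - 2 * (z t * (P * D (Some true) t + Q * D (Some false) t - (P + Q) * D None t)).
have VP (t : R) : 0 < t -> is_derive t 1 V (dV t).
  move=> t0.
  have h1 : is_derive t 1 (y (Some true)) (D (Some true) t) by exact: dy.
  have h2 : is_derive t 1 (y (Some false)) (D (Some false) t) by exact: dy.
  have h3 : is_derive t 1 (y None) (D None t) by exact: dy.
  have hx : is_derive t 1 x (D (Some true) t - D (Some false) t) by exact: is_deriveB.
  have hz : is_derive t 1 z
      (P * D (Some true) t + Q * D (Some false) t - (P + Q) * D None t).
    exact: is_derive_lincomb3.
  exact: is_derive_sqrB.
have cx : continuous x by move=> t; apply: cvgB; exact: cy.
have cz : continuous z.
  by move=> t; apply: cvgB; [apply: cvgD|]; apply: cvgZr; exact: cy.
have cV : continuous V.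
  by move=> t; apply: cvgB; apply: cvgM => //; [exact: cx|exact: cx|exact: cz|exact: cz].
have grow t : 0 < t -> c * (x t ^+ 2 + z t ^+ 2) <= dV t.
  move=> t0; have t0' := ltW t0.
  have := growth _ _ _ (yyd (Some true) (Some false) t t0') (yyd (Some true) None t t0')
    (yyd (Some false) None t t0').
  rewrite /dV /D /group_field.
  rewrite !(group_sum (fun l => coupling (group_sign _ l) eps (y l t - _))).
  rewrite /group_sign /= !subrr !coupling0 !mulr0 !addr0 !add0r.
  by rewrite -/P -/Q -/S.
have V0 : 0 < V 0.
  rewrite /V /x /z !fctE /GRing.scale /= !y0 /u0.
  rewrite [X in _ - X](_ : _ = 0); last by ring.
  rewrite subr0 exprn_gt0 // opprK -mulrDl mulr_gt0 //; lra.
have V_ge t : 0 <= t -> V 0 <= V t.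
  move=> t0; rewrite -lerN2.
  have cNV : {within `[0, +oo[, continuous (- V)}.
    by apply: continuous_subspaceT => s; apply: cvgN; exact: cV.
  refine (deriv_le_nonincreasing (f := - V) (df := - dV) (lexx 0) t0 cNV _).
  move=> s /andP[s0 _]; split.
    by have h := VP s s0; apply: is_derive_eq.
  rewrite oppr_le0; apply: le_trans (grow s s0).
  by apply: mulr_ge0; [exact: ltW | apply: addr_ge0; exact: sqr_ge0].
have V_lin t : 0 <= t -> c * V 0 * t <= V t.
  move=> t0.
  pose f : R -> R := (c * V 0) *: @idfun R - V.
  have cf : {within `[0, +oo[, continuous f}.
    apply: continuous_subspaceT => s; apply: cvgB; last exact: cV.
    by apply: cvgZr; exact: cvg_id.
  have : f t <= f 0.
    refine (deriv_le_nonincreasing (f := f) (df := fun s => c * V 0 - dV s)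
      (lexx 0) t0 cf _).
    move=> s /andP[s0 _]; split.
      by have h := VP s s0; apply: is_derive_eq; rewrite /GRing.scale /= mulr1.
    rewrite subr_le0; apply: le_trans (grow s s0); rewrite ler_pM2l //.
    apply: le_trans (V_ge s (ltW s0)) _; rewrite /V !fctE.
    by have := sqr_ge0 (z s); lra.
  by rewrite /f !fctE /GRing.scale /= mulr0 sub0r; move: (ltW V0); lra.
(* The time at which the linear lower bound on [V] reaches [d ^+ 2]. *)
pose T := d ^+ 2 / (c * V 0).
have cV0 : 0 < c * V 0 by rewrite mulr_gt0.
have T0 : 0 <= T by rewrite divr_ge0 ?ltW // exprn_gt0.
have := V_lin T T0; rewrite mulrC divfK ?gt_eqF // leNgt => /negP; apply.
rewrite /V !fctE; apply: (@le_lt_trans _ _ (x T ^+ 2)).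
  by have := sqr_ge0 (z T); lra.
rewrite -(ger0_norm (sqr_ge0 (x T))) normrX ltr_pXn2r ?nnegrE ?(ltW d0) //.
exact: yyd.
Qed.
End Instability.

(** * Bipolar equilibria of the network *)

Section Signs.
Variables (R : realType) (N : nat).
Implicit Types a b c : 'rV[R]_N.

Lemma binary_sqr a i : binary_pattern a -> a 0 i * a 0 i = 1.
Proof. by move=> /(_ i) [] ->; ring. Qed.

Lemma neg1_eq1F : ((-1 : R) == 1) = false.
Proof. by apply/negbTE/eqP; lra. Qed.

Lemma binary_mul a b i j : binary_pattern a -> binary_pattern b ->
  a 0 i * b 0 j = if a 0 i == b 0 j then 1 else -1.
Proof.
by move=> /(_ i) [] -> /(_ j) [] ->;
  rewrite ?eqxx ?neg1_eq1F 1?eq_sym ?neg1_eq1F; ring.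
Qed.

Lemma binary_eq_trans a b c i :
  binary_pattern a -> binary_pattern b -> binary_pattern c ->
  (a 0 i == c 0 i) = ((a 0 i == b 0 i) == (b 0 i == c 0 i)).
Proof.
by move=> /(_ i) [] -> /(_ i) [] -> /(_ i) [] ->;
  rewrite ?eqxx ?neg1_eq1F 1?[1 == _]eq_sym ?neg1_eq1F.
Qed.

Lemma sum_signs (P : pred 'I_N) :
  \sum_i (if P i then 1 else -1) = 2 * #|P|%:R - N%:R :> R.
Proof.
rewrite (bigID P) /= (eq_bigr (fun=> 1)) => [|i -> //].
rewrite sumr_const (eq_bigr (fun=> -1)) => [|i /negbTE -> //].
rewrite sumr_const.
have /(congr1 (fun n => n%:R : R)) := cardC P; rewrite card_ord natrD => <-.
by rewrite mulNrn; ring.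
Qed.

(* Both sides are invariant under shifts of [w]; for [w] of mean zero, the left-hand
   side is [2 (sum s) (sum s w^2) - 2 (sum s w)^2]. *)
Lemma sum_sign_diff_le (s w : 'I_N -> R) : (0 < N)%N -> (forall i, s i * s i = 1) ->
  \sum_i \sum_j s i * s j * (w j - w i) ^+ 2 <=
  `|\sum_i s i| / N%:R * \sum_i \sum_j (w j - w i) ^+ 2.
Proof.
move=> N0 s1.
have Np : 0 < N%:R :> R by rewrite ltr0n.
pose u i := w i - (\sum_j w j) / N%:R.
have u0 : \sum_i u i = 0.
  rewrite sumrB sumr_const card_ord -[_ / _ *+ _]mulr_natr divfK ?subrr //.
  by rewrite gt_eqF.
have wu i j : w j - w i = u j - u i by rewrite /u; ring.
have -> : \sum_i \sum_j s i * s j * (w j - w i) ^+ 2 =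
    \sum_i \sum_j s i * s j * (u j - u i) ^+ 2.
  by apply: eq_bigr => i _; apply: eq_bigr => j _; rewrite wu.
have -> : \sum_i \sum_j (w j - w i) ^+ 2 =
    \sum_i \sum_j (u j - u i) * (u j - u i).
  by apply: eq_bigr => i _; apply: eq_bigr => j _; rewrite wu expr2.
rewrite sum_sum_diff u0 !mulr0 subr0.
have -> : \sum_i \sum_j s i * s j * (u j - u i) ^+ 2 =
    \sum_i \sum_j s i * (s j * u j ^+ 2) + \sum_i \sum_j (s i * u i ^+ 2) * s j
    - 2 * \sum_i \sum_j (s i * u i) * (s j * u j).
  rewrite mulr_sumr -!big_split -sumrB /=; apply: eq_bigr => i _.
  rewrite mulr_sumr -!big_split -sumrB /=; apply: eq_bigr => j _; ring.
rewrite !sum_sum_mul.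
set sg := \sum_i s i; set A := \sum_i s i * u i ^+ 2; set B := \sum_i s i * u i.
set U := \sum_i u i * u i.
have AU : `|A| <= U.
  apply: le_trans (ler_norm_sum _ _ _) _; apply: ler_sum => i _.
  have si : `|s i| = 1.
    apply/eqP; rewrite -(eqrXn2 (n := 2)) // expr1n -normrX expr2 s1.
    by rewrite normr1.
  by rewrite normrM si mul1r ger0_norm ?sqr_ge0 // expr2.
have -> : `|sg| / N%:R * (2 * N%:R * U) = 2 * (`|sg| * U) by field; rewrite gt_eqF.
have h : sg * A <= `|sg| * U.
  by apply: le_trans (ler_norm _) _; rewrite normrM ler_wpM2l.
by have := sqr_ge0 B; lra.
Qed.
End Signs.

(** * Trigonometry at a bipolar equilibrium *)

Section Bipolar.
Variables (R : realType) (N : nat).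

Lemma sinDz (x : R) (k : int) : sin (x + k%:~R * (2 * pi)) = sin x.
Proof.
have e (n : nat) : n%:R * (2 * pi) = pi *+ 2 *+ n :> R.
  by rewrite mulr_natl mulr_natl.
case: k => n.
  by rewrite -pmulrn e (periodicn (@sinD2pi R)).
rewrite NegzE mulrNz mulNr -pmulrn e -[in RHS](subrK (pi *+ 2 *+ n.+1) x).
by rewrite (periodicn (@sinD2pi R)).
Qed.

Lemma bipolar_diff (eta phi : 'rV[R]_N) i j : bipolar eta phi ->
  exists k : int, phi 0 j - phi 0 i =
    (if eta 0 i == eta 0 j then 0 else pi) + k%:~R * (2 * pi).
Proof.
move=> /(_ i j) [k]; set t := if _ then _ else _ => E.
have [h|h] := leP 0 (phi 0 i - phi 0 j); last first.
  by exists k; rewrite -E ltr0_norm // opprB.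
move: E; rewrite ger0_norm // => E.
rewrite -opprB E /t; case: ifP => _.
  by exists (- k); rewrite mulrNz; ring.
by exists (- k - 1); rewrite mulrzBr mulrNz; ring.
Qed.

Lemma bipolar_sin (eta phi : 'rV[R]_N) i j (z : R) : binary_pattern eta ->
  bipolar eta phi -> sin (phi 0 j - phi 0 i + z) = eta 0 i * eta 0 j * sin z.
Proof.
move=> he /(bipolar_diff i j) [k ->]; rewrite addrAC sinDz binary_mul //.
by case: ifP => _; rewrite ?add0r ?mul1r // addrC sinDpi mulN1r.
Qed.

Lemma bipolar_sin2 (eta phi : 'rV[R]_N) i j (z : R) :
  bipolar eta phi -> sin (2 * (phi 0 j - phi 0 i + z)) = sin (2 * z).
Proof.
move=> /(bipolar_diff i j) [k ->]; case: ifP => _.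
  rewrite (_ : 2 * _ = 2 * z + (k + k)%:~R * (2 * pi)); first exact: sinDz.
  by rewrite intrD; ring.
rewrite (_ : 2 * _ = 2 * z + (1 + k + k)%:~R * (2 * pi)); first exact: sinDz.
by rewrite !intrD; ring.
Qed.
End Bipolar.

(** * The stability threshold of one pattern *)

Section Threshold.
Variables (R : realType) (N : nat) (a b c : 'rV[R]_N).
Hypotheses (ha : binary_pattern a) (hb : binary_pattern b) (hc : binary_pattern c).
Hypothesis onto : forall x y : bool,
  exists i, (a 0 i == b 0 i) = x /\ (a 0 i == c 0 i) = y.

Definition rotated_coupling i j : R :=
  1 + (a 0 i * b 0 i) * (a 0 j * b 0 j) + (a 0 i * c 0 i) * (a 0 j * c 0 j).

(** A phase offset of 0 or [pi] multiplies the first harmonic by [a_i a_j] and leaves the second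
    unchanged. Absorbing that sign into the weight turns the term of [a] into 1 and yields
    [rotated_coupling]. *)
Lemma oscillator_field_bipolar eps phi v i : bipolar a phi ->
  oscillator_field a b c eps (phi + v) 0 i =
  N%:R^-1 * \sum_j coupling (rotated_coupling i j) eps (v 0 j - v 0 i).
Proof.
move=> hphi; rewrite mxE [eps / _]mulrC -mulrA -mulrDr; congr (_ * _).
rewrite mulr_sumr -big_split /=; apply: eq_bigr => j _.
have -> : (phi + v) 0 j - (phi + v) 0 i = phi 0 j - phi 0 i + (v 0 j - v 0 i).
  by rewrite !mxE; ring.
rewrite (bipolar_sin2 _ _ _ hphi) (bipolar_sin _ _ _ ha hphi) /coupling.
congr (_ + _); rewrite mulrA; congr (_ * _).
rewrite /rotated_coupling.
have := binary_sqr i ha; have := binary_sqr j ha.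
move: (a 0 i) (a 0 j) => x y yy xx.
have -> : (x * y + b 0 i * b 0 j + c 0 i * c 0 j) * (x * y) =
  (x * x) * (y * y) + (x * b 0 i) * (y * b 0 j) + (x * c 0 i) * (y * c 0 j) by ring.
by rewrite xx yy mul1r.
Qed.

Let agree : R := #|[pred j | b 0 j == c 0 j]|%:R.

Lemma N_gt0 : (0 < N)%N.
Proof. by have [i _] := onto true true; exact: leq_ltn_trans (ltn_ord i). Qed.

Let s i := b 0 i * c 0 i.

Lemma s_sqr i : s i * s i = 1.
Proof. by rewrite /s mulrACA !binary_sqr ?mulr1. Qed.

Lemma sum_s : \sum_i s i = 2 * agree - N%:R.
Proof.
rewrite /agree -sum_signs; apply: eq_bigr => i _; exact: binary_mul.
Qed.

Lemma norm_sum_s : `|\sum_i s i| / N%:R = 2 * `|agree / N%:R - 1 / 2|.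
Proof.
have Np : 0 < N%:R :> R by rewrite ltr0n N_gt0.
have -> : \sum_i s i = 2 * N%:R * (agree / N%:R - 1 / 2).
  by rewrite sum_s; field; rewrite gt_eqF.
by rewrite normrM gtr0_norm ?mulr_gt0 // mulrAC mulfK ?gt_eqF.
Qed.

Lemma rotated_couplingE i j : rotated_coupling i j =
  - (s i * s j) + (1 + (a 0 i * b 0 i) * (a 0 j * b 0 j)) *
                  (1 + (a 0 i * c 0 i) * (a 0 j * c 0 j)).
Proof.
rewrite /rotated_coupling /s.
have := binary_sqr i ha; have := binary_sqr j ha.
move: (a 0 i) (a 0 j) => x y yy xx.
have -> : (1 + (x * b 0 i) * (y * b 0 j)) * (1 + (x * c 0 i) * (y * c 0 j)) =
  1 + (x * b 0 i) * (y * b 0 j) + (x * c 0 i) * (y * c 0 j)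
  + (x * x) * (y * y) * (b 0 i * c 0 i * (b 0 j * c 0 j)) by ring.
by rewrite xx yy; ring.
Qed.

Lemma rotated_coupling_ge i j : - (s i * s j) <= rotated_coupling i j.
Proof.
rewrite rotated_couplingE lerDl; apply: mulr_ge0.
  by rewrite !binary_mul //; case: ifP => _; case: ifP => _; lra.
by rewrite !binary_mul //; case: ifP => _; case: ifP => _; lra.
Qed.

Lemma rotated_coupling_le3 i j : `|rotated_coupling i j| <= 3.
Proof.
rewrite /rotated_coupling !binary_mul // ler_norml.
by do 4 case: ifP => _; apply/andP; split; lra.
Qed.

Lemma rotated_coupling_sym i j : rotated_coupling i j = rotated_coupling j i.
Proof. by rewrite /rotated_coupling; ring. Qed.

Lemma bipolar_stable eps phi : 0 < eps -> bipolar a phi ->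
  `|agree / N%:R - 1 / 2| < eps ->
  asymptotically_stable_mod_shift (oscillator_field a b c eps) phi.
Proof.
move=> eps0 hphi; set es := `|_| => ese.
have r0 : 0 < eps - es by rewrite subr_gt0.
have [d d0 dP] := coupling_near0 (ltW eps0) (ler0n R 3) r0.
apply: (@dissipative_asymptotically_stable R N N_gt0 _ _
  (fun i j => coupling (rotated_coupling i j) eps) _ _ d (eps - es)) => //.
- by move=> v i; exact: oscillator_field_bipolar.
- by move=> i j z; rewrite rotated_coupling_sym couplingN.
move=> v vd.
(* The linear part is at least [2 * (eps - es)] times the spread. Half of this margin absorbs the
   nonlinear error, and the other half is the dissipation rate. *)
apply: (@le_trans _ _ (\sum_i \sum_j (2 * eps - (eps - es)) * (v 0 j - v 0 i) ^+ 2
    - \sum_i \sum_j s i * s j * (v 0 j - v 0 i) ^+ 2)).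
  have := sum_sign_diff_le (fun i => v 0 i) N_gt0 s_sqr.
  rewrite norm_sum_s -/es.
  under [X in _ <= X - _]eq_bigr do rewrite -mulr_sumr.
  rewrite -mulr_sumr; lra.
rewrite -sumrB; apply: ler_sum => i _; rewrite -sumrB; apply: ler_sum => j _.
set z := v 0 j - v 0 i.
have hz := dP _ z (rotated_coupling_le3 i j) (vd i j).
have K := rotated_coupling_ge i j.
have {}K : - (s i * s j) * z ^+ 2 <= rotated_coupling i j * z ^+ 2.
  by rewrite ler_wpM2r // sqr_ge0.
set h := coupling _ _ _ in hz *.
have : - (z * (h - (rotated_coupling i j + 2 * eps) * z)) <= (eps - es) * z ^+ 2.
  rewrite -normrN in hz.
  apply: le_trans (ler_norm _) _; rewrite -mulrN normrM.
  apply: le_trans (ler_wpM2l (normr_ge0 z) hz) _.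
  by rewrite mulrCA -expr2 -normrX ger0_norm ?sqr_ge0.
lra.
Qed.

Lemma bipolar_unstable eps phi : 0 < eps -> bipolar a phi ->
  eps < `|agree / N%:R - 1 / 2| ->
  unstable (oscillator_field a b c eps) phi.
Proof.
move=> eps0 hphi epss.
have Np : 0 < N%:R :> R by rewrite ltr0n N_gt0.
have big : 2 * eps * N%:R < `|2 * agree - N%:R|.
  by rewrite -sum_s -ltr_pdivlMr // norm_sum_s ltr_pM2l.
(* [sg] tells whether agreement of [b] and [c] is the majority case; [cl] splits that majority by
   agreement of [a] with [b]. *)
pose sg := 0 <= 2 * agree - N%:R.
pose cl i := if (b 0 i == c 0 i) == sg then Some (a 0 i == b 0 i) else None.
apply: (@group_unstable R N _ _ cl eps) => //.
- move=> y i; rewrite oscillator_field_bipolar //; congr (_ * _).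
  apply: eq_bigr => j _; rewrite !mxE.
  (* Within a group the phases coincide and the coupling vanishes whatever its strength, so
     [group_sign] has to match [rotated_coupling] only across distinct groups. *)
  have [->|ne] := eqVneq (cl j) (cl i).
    by rewrite subrr !coupling0.
  congr (coupling _ _ _).
  rewrite /rotated_coupling !binary_mul // /group_sign; move: ne; rewrite /cl.
  have tr k := binary_eq_trans k ha hb hc.
  rewrite !tr.
  by case: (a 0 i == b 0 i); case: (a 0 j == b 0 j); case: (b 0 i == c 0 i);
    case: (b 0 j == c 0 j); case: (sg) => //= _; ring.
- move=> l.
  have tr k := binary_eq_trans k hb ha hc.
  case: l => [x|].
    (* [b] and [c] agree exactly when the two bits are equal, and [x == (x == sg)] is [sg], so this
       index lies in the majority class. *)
    have [i [ix iy]] := onto x (x == sg).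
    by exists i; rewrite /cl tr [b 0 i == a 0 i]eq_sym ix iy; case: (x); case: (sg).
  have [i [ix iy]] := onto true (~~ sg).
  by exists i; rewrite /cl tr [b 0 i == a 0 i]eq_sym ix iy; case: (sg).
have := group_sizeD R cl.
have : group_size R cl None = #|[pred j | (b 0 j == c 0 j) != sg]|%:R.
  congr (_%:R); apply: eq_card => j; rewrite !inE /cl.
  by case: ((b 0 j == c 0 j) == sg).
have agreeC : N%:R - agree = #|[pred j | b 0 j != c 0 j]|%:R.
  have /(congr1 (fun n => n%:R : R)) := cardC [pred j | b 0 j == c 0 j].
  rewrite card_ord natrD => <-.
  by rewrite addrC addKr; congr (_%:R); apply: eq_card => j; rewrite !inE.
move=> gN gD; have [h|h] := boolP sg.
  have {}gN : group_size R cl None = N%:R - agree.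
    by rewrite gN agreeC; congr (_%:R); apply: eq_card => j; rewrite !inE h eqb_id.
  by move: big; rewrite ger0_norm //; lra.
have {}gN : group_size R cl None = agree.
  rewrite gN /agree; congr (_%:R); apply: eq_card => j; rewrite !inE (negbTE h).
  by case: (b 0 j == c 0 j).
by move: big; rewrite ltr0_norm ?ltNge //; lra.
Qed.

(** Stated for the pattern listed first; the other two follow by exchanging patterns, since the
    field is symmetric in them. *)
Theorem bipolar_threshold :
  stability_threshold a b c a `|agree / N%:R - 1 / 2|.
Proof.
move=> eps phi eps0 hphi; split.
- apply/rowP => i; rewrite -[phi]addr0 oscillator_field_bipolar //.
  by rewrite big1 ?mulr0 ?mxE // => j _; rewrite !mxE subrr coupling0.
- exact: bipolar_stable.
- exact: bipolar_unstable.
Qed.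
End Threshold.

(** * Exchanging patterns and the three thresholds *)

Lemma oscillator_field_swap12 (R : realType) (N : nat) (a b c : 'rV[R]_N) :
  oscillator_field b a c = oscillator_field a b c.
Proof.
apply: funext => eps; apply: funext => phi; apply/rowP => i; rewrite !mxE.
congr (_ * _ + _); apply: eq_bigr => j _; congr (_ * _).
by ring.
Qed.

Lemma oscillator_field_swap13 (R : realType) (N : nat) (a b c : 'rV[R]_N) :
  oscillator_field c b a = oscillator_field a b c.
Proof.
apply: funext => eps; apply: funext => phi; apply/rowP => i; rewrite !mxE.
congr (_ * _ + _); apply: eq_bigr => j _; congr (_ * _).
by ring.
Qed.

Theorem theorem3p1 (R : realType) (N : nat) (xi1 xi2 xi3 : 'rV[R]_N)
  (hxi1 : binary_pattern xi1) (hxi2 : binary_pattern xi2)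
  (hxi3 : binary_pattern xi3)
  (h12 : xi1 <> xi2 /\ xi1 <> - xi2)
  (h13 : xi1 <> xi3 /\ xi1 <> - xi3)
  (h23 : xi2 <> xi3 /\ xi2 <> - xi3)
  (hJ11 : J11 xi1 xi2 xi3 != finset.set0)
  (hJ12 : J12 xi1 xi2 xi3 != finset.set0)
  (hJ21 : J21 xi1 xi2 xi3 != finset.set0)
  (hJ22 : J22 xi1 xi2 xi3 != finset.set0) :
  [/\ stability_threshold xi1 xi2 xi3 xi1
        `| #|J11 xi1 xi2 xi3 :|: J12 xi1 xi2 xi3|%:R / N%:R - 1 / 2 |,
      stability_threshold xi1 xi2 xi3 xi2
        `| #|J11 xi1 xi2 xi3 :|: J22 xi1 xi2 xi3|%:R / N%:R - 1 / 2 | &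
      stability_threshold xi1 xi2 xi3 xi3
        `| #|J11 xi1 xi2 xi3 :|: J21 xi1 xi2 xi3|%:R / N%:R - 1 / 2 |].
Proof.
pose ev := (neg1_eq1F R, opprK, eqxx, eq_sym (1 : R) (-1)).
(* [J11], [J21], [J22] and [J12] are the four combinations of agreement of [xi1] with [xi2] and with
   [xi3]. *)
have onto (x y : bool) : exists i,
    (xi1 0 i == xi2 0 i) = x /\ (xi1 0 i == xi3 0 i) = y.
  case: x y => [] [].
  - move/set0Pn: hJ11 => [i]; rewrite inE => /andP[/eqP e1 /eqP e2].
    by exists i; rewrite e1 e2 eqxx.
  - move/set0Pn: hJ21 => [i]; rewrite inE => /andP[/eqP e1 /eqP e2].
    by exists i; rewrite e1 -e2; case: (hxi3 i) => ->; rewrite !ev.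
  - move/set0Pn: hJ22 => [i]; rewrite inE => /andP[/eqP e1 /eqP /oppr_inj e2].
    by exists i; rewrite e1 -e2; case: (hxi3 i) => ->; rewrite !ev.
  - move/set0Pn: hJ12 => [i]; rewrite inE => /andP[/eqP e1 /eqP e2].
    by exists i; rewrite e1 e2; case: (hxi1 i) => ->; rewrite !ev.
split.
- have -> : #|J11 xi1 xi2 xi3 :|: J12 xi1 xi2 xi3| = #|[pred j | xi2 0 j == xi3 0 j]|.
    apply: eq_card => i; rewrite !inE.
    by case: (hxi1 i) => ->; case: (hxi2 i) => ->; case: (hxi3 i) => ->; rewrite !ev.
  exact: bipolar_threshold.
- have -> : #|J11 xi1 xi2 xi3 :|: J22 xi1 xi2 xi3| = #|[pred j | xi1 0 j == xi3 0 j]|.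
    apply: eq_card => i; rewrite !inE.
    by case: (hxi1 i) => ->; case: (hxi2 i) => ->; case: (hxi3 i) => ->; rewrite !ev.
  rewrite /stability_threshold -oscillator_field_swap12.
  apply: bipolar_threshold => // x y.
  (* With [xi2] as reference pattern, the agreement of [xi1] with [xi3] is determined by the two
     prescribed bits as [x == y]. *)
  have [i [ix iy]] := onto x (x == y).
  by exists i; rewrite (binary_eq_trans _ hxi2 hxi1 hxi3) [xi2 0 i == _]eq_sym ix iy;
    case: (x); case: (y).
- have -> : #|J11 xi1 xi2 xi3 :|: J21 xi1 xi2 xi3| = #|[pred j | xi2 0 j == xi1 0 j]|.
    apply: eq_card => i; rewrite !inE.
    by case: (hxi1 i) => ->; case: (hxi2 i) => ->; case: (hxi3 i) => ->; rewrite !ev.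
  rewrite /stability_threshold -oscillator_field_swap13.
  apply: bipolar_threshold => // x y.
  have [i [ix iy]] := onto (x == y) y.
  by exists i; rewrite (binary_eq_trans _ hxi3 hxi1 hxi2) [xi3 0 i == _]eq_sym ix iy;
    case: (x); case: (y).
Qed.
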